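(* Let $t\ge 2$ and let $a_1>a_2>\cdots>a_{t-1}>a_t=1$ be natural numbers. Let $g$ be a non-negative integer satisfying \begin{enumerate} \item $g\ge 2a_1+t-1$; \item $\#\big\{a_i+a_j\mid i,j\in\{1,2,\ldots,t\}\big\}>3(t-1)$. \end{enumerate} Put $m=g-t+1$. Then the semigroup $H$ with gap set $$G(H)=\{1,\ldots,g-t,\;2m-a_1,\ldots,2m-a_t\}$$ (that is, $H=\mathbb{N}\setminus G(H)$, which is a numerical semigroup) is a 2-Buchweitz PF-semigroup.
   Context: A numerical semigroup $H$ is an additive submonoid of $\mathbb{N}=\{0,1,2,\ldots\}$ whose set of gaps $G(H)=\mathbb{N}\setminus H$ is finite. Its genus is $g(H)=\#G(H)$ and its multiplicity $m(H)$ is its least positive element. The set of pseudo-Frobenius numbers is $PF(H)=\{x\in G(H)\mid x+h\in H \text{ for all } h\in H\setminus\{0\}\}$, and the type is $t(H)=\#PF(H)$. $H$ is a PF-semigroup if $G(H)=\{1,\ldots,g(H)-t(H)\}\sqcup PF(H)$ (disjoint union) and $\min PF(H)>m(H)$ (in particular $PF(H)\neq\emptyset$). $H$ is 2-Buchweitz if $\#G_2(H)>3(g(H)-1)$, where $G_2(H)=\{x+y\mid x,y\in G(H)\}$. *)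

(* Defs.v *)
From mathcomp Require Import all_boot all_order all_algebra finmap.
From mathcomp Require Import all_classical.

Set Implicit Arguments.
Unset Strict Implicit.
Unset Printing Implicit Defensive.

Local Open Scope nat_scope.
Local Open Scope classical_set_scope.

(* Junk values: [0] on infinite sets for [set_card], [0] on the empty set for
   [least]. *)
Definition set_card (A : set nat) : nat := (#|` fset_set A|)%fset.

Definition least (A : set nat) : nat :=
  xget 0 [set n | A n /\ forall k, A k -> n <= k].

Definition gaps (H : set nat) : set nat := ~` H.

Definition numerical_semigroup (H : set nat) : Prop :=
  [/\ H 0, (forall x y, H x -> H y -> H (x + y)) & finite_set (gaps H)].

Definition genus (H : set nat) : nat := set_card (gaps H).

Definition multiplicity (H : set nat) : nat := least [set h | H h /\ 0 < h].

Definition pseudo_Frobenius (H : set nat) : set nat :=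
  [set x | gaps H x /\ forall h, H h -> h <> 0 -> H (x + h)].

Definition sg_type (H : set nat) : nat := set_card (pseudo_Frobenius H).

(* For a numerical semigroup [H] the difference [genus H - sg_type H] is never
   truncated, since the pseudo-Frobenius numbers are gaps. *)
Definition PF_semigroup (H : set nat) : Prop :=
  [/\ gaps H =
        [set x | 1 <= x <= genus H - sg_type H] `|` pseudo_Frobenius H,
      [set x | 1 <= x <= genus H - sg_type H] `&` pseudo_Frobenius H = set0,
      pseudo_Frobenius H !=set0
    & multiplicity H < least (pseudo_Frobenius H)].

Definition gap_sums (H : set nat) : set nat :=
  [set x + y | x in gaps H & y in gaps H].

(* The inequality is stated in [int] because [genus H - 1] would be truncated
   in [nat] when [genus H = 0]. *)
Definition two_Buchweitz (H : set nat) : Prop :=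
  (3 * ((genus H)%:Z - 1) < (set_card (gap_sums H))%:Z)%R.

(* Main.v *)
(* With [m = g - t + 1], the gaps are [1, m - 1] and the [2 m - a_i], the latter
   lying in [m + a_1, 2 m - 1]; hence a sum of two nonzero elements of [H] is at
   least [2 m].  The [2 m - a_i] are therefore pseudo-Frobenius, and no
   [0 < x < m] is: either [h = 2 m - 1 - x] is in [H], or [x = a_i - 1] for some
   [i] and [h = 2 m - a_1 - x] is in [H]; in both cases [x + h] is a gap.
   Finally [G_2(H)] contains the [3 m - 3] integers of [2, 3 m - 2] and, above
   them, the [4 m - (a_i + a_j)], more than [3 (t - 1)] in number, while
   [3 (g - 1) = 3 m - 3 + 3 (t - 1)]. *)
Require Import Defs.
From mathcomp Require Import all_boot all_order all_algebra finmap.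
From mathcomp Require Import all_classical.
From mathcomp Require Import zify.

Local Open Scope nat_scope.
Local Open Scope classical_set_scope.

Lemma set_cardU (A B : set nat) : finite_set A -> finite_set B ->
  A `&` B = set0 -> set_card (A `|` B) = set_card A + set_card B.
Proof.
move=> fA fB AB; rewrite /set_card fset_setU // cardfsU -fset_setI // AB.
by rewrite fset_set0 cardfs0 subn0.
Qed.

Lemma set_card_image (f : nat -> nat) (A : set nat) : finite_set A ->
  (forall x y, A x -> A y -> f x = f y -> x = y) ->
  set_card [set f x | x in A] = set_card A.
Proof.
move=> fA injf; rewrite /set_card fset_set_image // card_in_imfset //=.
by move=> x y; rewrite !in_fset_set // !inE; apply: injf.
Qed.

(** Finiteness of [B] excludes the junk value: an infinite [B] would have [set_card B = 0]. *)
Lemma set_cardS (A B : set nat) :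
  finite_set B -> A `<=` B -> set_card A <= set_card B.
Proof.
move=> fB AB; have fA := sub_finite_set AB fB.
by apply: fsubset_leq_card; rewrite -fset_set_sub.
Qed.

Lemma finite_interval (p q : nat) : finite_set [set x | p <= x <= q].
Proof. by apply: (sub_finite_set _ (finite_II q.+1)) => x /= /andP[]. Qed.

(** Counted by translating [I_n]; the half-open form avoids truncated subtraction. It serves with
    [p = 0] for [[1, n]] and [p = 1] for [[2, n + 1]]. *)
Lemma set_card_interval (p n : nat) : set_card [set x | p < x <= p + n] = n.
Proof.
have -> : [set x | p < x <= p + n] = [set p.+1 + x | x in `I_n].
  apply/seteqP; split=> [x /= xpn|_ [x /= xn <-]]; last by lia.
  by exists (x - p.+1); lia.
rewrite set_card_image; [|exact: finite_II|by move=> x y _ _; lia].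
exact: card_fset_set (card_eqxx _).
Qed.

(** By well-ordering, the default [0] of [xget] is never reached on a nonempty set. *)
Lemma leastP (A : set nat) : A !=set0 ->
  A (least A) /\ forall k, A k -> least A <= k.
Proof.
move=> [x Ax]; rewrite /least; case: xgetP => [y _ //|noleast].
have exA : exists n, `[< A n >] by exists x; apply/asboolP.
case: (ex_minnP exA) => n /asboolP An minn.
by case: (noleast n); split=> // k Ak; apply/minn/asboolP.
Qed.

Theorem theorem3p1 (t : nat) (a : nat -> nat) (g : nat)
  (ht : 2 <= t)
  (ha : forall i j, 1 <= i -> i < j -> j <= t -> a j < a i)
  (hat : a t = 1)
  (hg : 2 * a 1 + t - 1 <= g)
  (hsums : 3 * (t - 1) <
     set_card [set a i + a j | i in [set i | 1 <= i <= t]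
                         & j in [set j | 1 <= j <= t]]) :
  let m := g - t + 1 in
  let G := [set x | 1 <= x <= g - t] `|`
           [set 2 * m - a i | i in [set i | 1 <= i <= t]] in
  let H := ~` G in
  [/\ numerical_semigroup H, PF_semigroup H & two_Buchweitz H].
Proof.
move=> m G H.
have a_bounds i : 1 <= i <= t -> 1 <= a i <= a 1.
  move=> it; apply/andP; split.
    by have [->|it'] := eqVneq i t; [lia|have := ha i t; lia].
  by have [->//|i1] := eqVneq i 1; have := ha 1 i; lia.
(* Since [t >= 2]; this makes [a 1 - 1] a positive gap, used below to write [2 * m - 1] as a sum of
   gaps. *)
have a1_gt1 : 1 < a 1 by have := ha 1 t; lia.
have am : 2 * a 1 <= m by lia.
set P := [set 2 * m - a i | i in [set i | 1 <= i <= t]] in G H *.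
have P_bounds x : P x -> 2 * m - a 1 <= x < 2 * m.
  by move=> [i /= /a_bounds ai <-]; lia.
have P_first : P (2 * m - a 1) by exists 1 => //=; lia.
have P_last : P (2 * m - 1) by exists t; [rewrite /=; lia|rewrite hat].
have G_low x : 0 < x < m -> G x by move=> xm; left=> /=; lia.
have H0 : H 0 by case=> /= [|/P_bounds]; lia.
have H_high x : 2 * m <= x -> H x by move=> xm []/= => [|/P_bounds]; lia.
have H_mid x : m <= x < 2 * m - a 1 -> H x by move=> xm []/= => [|/P_bounds]; lia.
have H_ge x : H x -> x <> 0 -> m <= x.
  by move=> Hx x0; rewrite leqNgt; apply/negP => xm; apply/Hx/G_low; lia.
have finI : finite_set [set i | 1 <= i <= t] by exact: finite_interval.
have finP : finite_set P by exact: finite_image.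
have finG : finite_set G by rewrite finite_setU; split=> //; exact: finite_interval.
have gapsH : gaps H = G by rewrite /gaps setCK.
have disj : [set x | 1 <= x <= g - t] `&` P = set0.
  by apply/seteqP; split=> // x [/= xg /P_bounds]; lia.
have cardP : set_card P = t.
  rewrite set_card_image //; first exact: (set_card_interval 0).
  (* Injectivity: [a] is strictly decreasing, and [a i <= a 1 < 2 * m] keeps the subtraction from
     truncating. *)
  move=> i j /= it jt; have := a_bounds i it; have := a_bounds j jt.
  by case: (ltngtP i j) => // ij; [have := ha i j|have := ha j i]; lia.
have genusH : genus H = g.
  rewrite /genus gapsH set_cardU //; last exact: finite_interval.
  by rewrite cardP (set_card_interval 0); lia.
have PFH : pseudo_Frobenius H = P.
  apply/seteqP; split=> [x []|x Px].
    rewrite gapsH => -[/= xg|//] Hx; exfalso.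
    have [Gh|Hh] := pselect (G (2 * m - 1 - x)); last first.
      have /Hx : H (2 * m - 1 - x) by [].
      have -> : x + (2 * m - 1 - x) = 2 * m - 1 by lia.
      by apply=> [|]; [lia|right].
    case: Gh => [/=|/P_bounds xa]; first by lia.
    (* Here [2 * m - 1 - x] lies in [P], so [x < a 1] and
       [2 * m - a 1 - x > 2 * m - 2 * a 1 >= m]. *)
    have /Hx : H (2 * m - a 1 - x) by apply: H_mid; lia.
    have -> : x + (2 * m - a 1 - x) = 2 * m - a 1 by lia.
    by apply=> [|]; [lia|right].
  split=> [|h Hh h0]; first by rewrite gapsH; right.
  by apply: H_high; have := H_ge h Hh h0; have := P_bounds x Px; lia.
have typeH : sg_type H = t by rewrite /sg_type PFH.
split.
- split=> [//|x y Hx Hy|]; last by rewrite gapsH.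
  have [->//|/eqP x0] := eqVneq x 0.
  have [->|/eqP y0] := eqVneq y 0; first by rewrite addn0.
  by apply: H_high; have := H_ge x Hx x0; have := H_ge y Hy y0; lia.
- split; rewrite ?genusH ?typeH ?PFH ?gapsH //; first by exists (2 * m - 1).
  have [|/P_bounds Pleast _] := leastP P; first by exists (2 * m - 1).
  (* An upper bound is enough: [P] starts at [2 * m - a 1], which exceeds [m]. *)
  suff : multiplicity H <= m by lia.
  have Hm : [set h | H h /\ 0 < h] m by split; [apply: H_mid|]; lia.
  by have [|_] := leastP [set h | H h /\ 0 < h]; [exists m|exact].
- rewrite /two_Buchweitz genusH.
  set S := [set a i + a j | i in _ & j in _] in hsums.
  have S_bounds s : S s -> s <= 2 * a 1.
    by move=> [i /= /a_bounds ai [j /= /a_bounds aj <-]]; lia.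
  have finS : finite_set S by exact: finite_image2.
  have finG2 : finite_set (gap_sums H).
    by rewrite /gap_sums gapsH; exact: finite_image2.
  have low_card : set_card [set x | 1 < x <= 1 + (3 * m - 3)] = 3 * m - 3.
    exact: set_card_interval.
  have high_card : set_card [set 4 * m - s | s in S] = set_card S.
    by apply: set_card_image => // x y /S_bounds xa /S_bounds ya; lia.
  suff sub : [set x | 1 < x <= 1 + (3 * m - 3)] `|` [set 4 * m - s | s in S]
      `<=` gap_sums H.
    have := set_cardS _ _ finG2 sub.
    rewrite set_cardU ?low_card ?high_card; first by lia.
    + exact: finite_interval.
    + exact: finite_image.
    (* Disjoint, because [s <= 2 * a 1 <= m] gives [4 * m - s >= 3 * m]. *)
    + apply/seteqP; split=> // x [/= xm [s /S_bounds sa]]; lia.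
  have sumsI x y z : G x -> G y -> x + y = z -> gap_sums H z.
    by move=> Gx Gy <-; exists x; [rewrite gapsH|exists y; rewrite ?gapsH].
  move=> z [/= zm|[s [i /= it [j /= jt <-]] <-]]; last first.
    apply: (sumsI (2 * m - a i) (2 * m - a j));
      [by right; exists i|by right; exists j|].
    by have := a_bounds i it; have := a_bounds j jt; lia.
  (* Two gaps below [m] reach every [z] up to [2 * m - 2], and adding such a gap to [2 * m - 1]
     covers [[2 * m, 3 * m - 2]]. Only [z = 2 * m - 1] is missed; it is the sum of [2 * m - a 1] and
     [a 1 - 1]. *)
  have [zm1|zm1] := leqP z m.
    by apply: (sumsI 1 (z - 1)); [apply: G_low .. |]; lia.
  have [zm2|zm2] := leqP z (2 * m - 2).
    by apply: (sumsI (m - 1) (z - (m - 1))); [apply: G_low .. |]; lia.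
  have [->|zm3] := eqVneq z (2 * m - 1).
    by apply: (sumsI (2 * m - a 1) (a 1 - 1)); [by right|apply: G_low|]; lia.
  by apply: (sumsI (2 * m - 1) (z - (2 * m - 1))); [by right|apply: G_low|]; lia.
Qed.
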